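(* Let $\mathbb X$ be a finite set, $c\in\mathbb R^{\mathbb X}$, and $P=\Delta_{\mathbb X}\cap\mathcal L$ with $\mathcal L\subseteq\mathbb R^{\mathbb X}$ an affine space and $P\cap\mathbb R^{\mathbb X}_{>0}\neq\emptyset$. Let $(\mu_t)_{t\ge 0}\subseteq \operatorname{int}(P)$ be the solution of the Fisher-Rao gradient flow in $P$ with potential $f(\mu)=c^\top\mu$ and initial condition $\mu_0\in P\cap\mathbb R^{\mathbb X}_{>0}$. Let $F^\star$ denote the face of maximizers of $\mu\mapsto c^\top\mu$ over $P$ and assume $F^\star\neq P$. Let $\mu^\star=\arg\min_{\mu\in F^\star}D_{\mathrm{KL}}(\mu,\mu_0)$ be the information projection of $\mu_0$ to $F^\star$ and set $$\Delta:=\min\left\{\frac{c^\top\nu-c^\top\mu}{\lVert\nu-\mu\rVert_{\mathrm{TV}}}:\nu\in\operatorname{vert}(F^\star),\ \mu\in N(\nu)\setminus F^\star\right\}>0,$$ where $N(\nu)$ is the set of neighboring vertices of $\nu$ in $P$. Then for any $\kappa\in(0,\Delta)$ there is $t_\kappa\in\mathbb R_{\ge0}$ such that for any $t\ge t_\kappa$ we have $$D_{\mathrm{KL}}(\mu^\star,\mu_t)\le D_{\mathrm{KL}}(\mu^\star,\mu_0)\,e^{-\kappa(t-t_\kappa)}$$ and $$c^\top\mu^\star-c^\top\mu_t\le\Delta\, D_{\mathrm{KL}}(\mu^\star,\mu_0)\,e^{-\kappa(t-t_\kappa)}.$$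
   Context: $\Delta_{\mathbb X}=\{\mu\in\mathbb R^{\mathbb X}_{\ge0}:\sum_x\mu_x=1\}$ is the probability simplex. For a polytope $P$, $\operatorname{int}(P)$ is its relative interior (in its affine hull), $TP$ its tangent space, i.e. the linear part of its affine hull, and $\operatorname{vert}(\cdot)$ denotes the set of vertices. Two vertices $\mu_1,\mu_2$ of $P$ are neighbors if the set $\{a\in\mathbb R^{\mathbb X}: a^\top\mu_1=a^\top\mu_2=\max_{\mu\in P}a^\top\mu\}$ has dimension $|\mathbb X|-1$ (i.e. they are distinct and joined by an edge of $P$). $\lVert v\rVert_{\mathrm{TV}}=\frac12\sum_x|v_x|$. For $\mu,\nu\in\Delta_{\mathbb X}$ with $\nu_x=0\Rightarrow\mu_x=0$, $D_{\mathrm{KL}}(\mu,\nu)=\sum_x\mu_x\log\frac{\mu_x}{\nu_x}$ (with $0\log\frac00=0$). The Fisher-Rao metric is $g^{\mathrm{FR}}_\mu(v,w)=\sum_x\frac{v_xw_x}{\mu_x}$ for $\mu\in\mathbb R^{\mathbb X}_{>0}$. The Fisher-Rao gradient $\nabla^{\mathrm{FR}}_Pf(\mu)\in TP$ at $\mu\in\operatorname{int}(P)$ is determined by $g^{\mathrm{FR}}_\mu(\nabla^{\mathrm{FR}}_Pf(\mu),v)=\langle\nabla f(\mu),v\rangle$ for all $v\in TP$; the Fisher-Rao gradient flow is $\partial_t\mu_t=\nabla^{\mathrm{FR}}_Pf(\mu_t)$. It has a unique global solution $(\mu_t)_{t\ge0}\subseteq\operatorname{int}(P)$ for linear $f$.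 *)

(* Defs.v *)
From HB Require Import structures.
From mathcomp Require Import all_boot all_order all_algebra.
From mathcomp Require Import all_classical all_reals all_analysis.
Set Implicit Arguments.
Unset Strict Implicit.
Unset Printing Implicit Defensive.
Import Order.TTheory GRing.Theory Num.Theory.
Import numFieldNormedType.Exports.
Local Open Scope classical_set_scope.
Local Open Scope ring_scope.

(* R^o rather than R, so that vec R X is a finite-dimensional [vectType R]. *)
Notation vec R X := {ffun X -> R^o}.

Section AffineGeometry.
Variables (R : realType) (X : finType).
Implicit Types (A P S : set (vec R X)) (a b mu nu v : vec R X).

Definition dotp a b : R := \sum_x a x * b x.

Definition affine_set A : Prop :=
  forall mu nu (r : R), A mu -> A nu -> A ((1 - r) *: mu + r *: nu).

Definition affine_hull S : set (vec R X) := smallest affine_set S.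

(* The linear part of the affine hull: an affine set A has linear part A - A. *)
Definition tangent_space S : set (vec R X) :=
  [set v | exists mu nu, [/\ affine_hull S mu, affine_hull S nu & v = nu - mu]].

Definition has_dim S (d : nat) : Prop :=
  exists2 V : {vspace vec R X}, \dim V = d & tangent_space S = [set` V].

(* Openness is expressed with sup-norm balls. *)
Definition rel_int P : set (vec R X) :=
  [set mu | P mu /\ exists2 e : R, 0 < e &
    forall nu, affine_hull P nu -> (forall x, `|nu x - mu x| < e) -> P nu].

Definition argmax_face P a : set (vec R X) :=
  [set mu | P mu /\ forall nu, P nu -> dotp a nu <= dotp a mu].

(* Vertices are the zero-dimensional faces. *)
Definition vert P : set (vec R X) :=
  [set mu | exists a, argmax_face P a = [set mu]].

Definition neighbors P nu : set (vec R X) :=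
  [set mu | [/\ vert P nu, vert P mu &
    has_dim [set a | argmax_face P a nu /\ argmax_face P a mu] #|X|.-1]].

End AffineGeometry.

Section FisherRao.
Variables (R : realType) (X : finType).
Implicit Types (P F : set (vec R X)) (c mu nu v w : vec R X).

Definition simplex : set (vec R X) :=
  [set mu | (forall x, 0 <= mu x) /\ \sum_x (mu x : R) = 1].

Definition pos_orthant : set (vec R X) := [set mu | forall x, (0 : R) < mu x].

Definition tv_norm v : R := 2^-1 * \sum_x `|v x|.

(* Meaningful when nu x = 0 implies mu x = 0; the conventions y / 0 = 0 and
   ln 0 = 0 then make the terms with mu x = 0 vanish. *)
Definition KL mu nu : R := \sum_x mu x * ln (mu x / nu x : R).

Definition fr_metric mu v w : R := \sum_x v x * w x / mu x.

Definition basis_vec (x : X) : vec R X := [ffun y => (y == x)%:R].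

Definition euclid_grad (f : vec R X -> R) mu : vec R X :=
  [ffun x => derive1 (fun h : R => f (mu + h *: basis_vec x)) 0].

Definition is_fr_gradient P (f : vec R X -> R) mu w : Prop :=
  tangent_space P w /\
  forall v, tangent_space P v -> fr_metric mu w v = dotp (euclid_grad f mu) v.

(* Derivative relative to the time domain [0, +oo[, hence one-sided at 0. *)
Definition has_time_derivative (mu_ : R -> vec R X) (t : R) v : Prop :=
  forall x, ((mu_ s x - mu_ t x : R) / (s - t))
              @[s --> within [set s : R | 0 <= s] t^'] --> (v x : R).

(* Only the values of mu_ at nonnegative times matter. *)
Definition is_fr_gradient_flow P (f : vec R X -> R) (mu_ : R -> vec R X) : Prop :=
  forall t : R, 0 <= t -> rel_int P (mu_ t) /\
    exists2 v, is_fr_gradient P f (mu_ t) v & has_time_derivative mu_ t v.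

Definition is_info_projection F mu0 mu : Prop :=
  F mu /\ forall nu, F nu -> KL mu mu0 <= KL nu mu0.

Definition slopes P c : set R :=
  [set r | exists nu mu,
    [/\ vert (argmax_face P c) nu, neighbors P nu mu, ~ argmax_face P c mu &
        r = (dotp c nu - dotp c mu) / tv_norm (nu - mu)]].

Definition is_min (S : set R) (m : R) : Prop := S m /\ lbound S m.

End FisherRao.
Arguments simplex : clear implicits.
Arguments pos_orthant : clear implicits.

(* Main.v *)
Require Import Defs.
From HB Require Import structures.
From mathcomp Require Import all_boot all_order all_algebra.
From mathcomp Require Import all_classical all_reals all_analysis.
From mathcomp Require Import ring lra.
Import Order.TTheory GRing.Theory Num.Theory.
Import numFieldNormedType.Exports.
Local Open Scope classical_set_scope.
Local Open Scope ring_scope.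

(** Along the flow, [KL nu (mu_ t)] has derivative [- (c nu - c mu_t)] for every
    [nu] in [P] ([is_derive_KL]): the Fisher-Rao pairing of the velocity with
    [nu - mu_t] is the time derivative of the divergence up to sign. If the gap
    [c mustar - c mu_t] is eventually at least [kappa] times the divergence [V] from
    [mustar], then [V' <= - kappa V], and Gronwall's lemma yields the first estimate
    ([KL_exp_decay]). The gap is nonincreasing, because the flow ascends, so it is
    at most its mean over the preceding unit of time, that is at most [V (t - 1)]
    ([gap_le_KL]); enlarging [tk] absorbs the constant in the second estimate.

    The point is therefore to compare [V] with the gap for large times
    ([gap_ge_KL]). The cone spanned by [P] at a vertex [nu] of the optimal face is
    generated by the edges at [nu] ([edge_cone_ind]). Write [mu_t - nu] as a
    nonnegative combination of edges and discard those that leave the optimal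
    face: what remains is [n - nu] with [n] in the affine hull of the face, and by
    definition of [Delta] each discarded edge loses at least [Delta] per unit of
    total variation, so [Delta * TV (n - mu_t)] is at most the gap
    ([optimal_part]). The gap is at most [V 0 / t], so [n] approaches [mu_t]. As the
    coordinates of [mu_t] in the support of the optimal face stay bounded below
    ([flow_lower_bound]), [n] is eventually nonnegative, hence in the face, and
    [KL n mu_t] is at most [(1 + o(1)) TV (n - mu_t)] ([KL_le_tv]). Finally
    [V <= KL n mu_t], because all divergences from points of the optimal face
    change by the same amount along the flow, so that [mustar] remains the
    information projection of [mu_t] ([KL_min_invariant]).

    Vertices and edges are handled through supports: a point of [P] is a vertex as
    soon as no nonzero tangent direction is supported in its support. Extreme rays
    of the tangent cone are found by minimizing supports, and every descent step is
    a ratio test ([ratio_test]). *)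

Set Implicit Arguments.
Unset Strict Implicit.
Unset Printing Implicit Defensive.

(** * Coordinates, pairing and total variation *)

Section VectorAlgebra.
Variables (R : realType) (X : finType).
Implicit Types (a u v : vec R X) (r : R).

Lemma addvE u v x : (u + v) x = u x + v x :> R.
Proof. by rewrite ffunE. Qed.

Lemma oppvE u x : (- u) x = - u x :> R.
Proof. by rewrite ffunE. Qed.

Lemma scalevE r u x : (r *: u) x = r * u x :> R.
Proof. by rewrite ffunE. Qed.

Lemma zerovE x : (0 : vec R X) x = 0 :> R.
Proof. by rewrite ffunE. Qed.

Lemma vecP u v : (forall x, (u x : R) = v x) -> u = v.
Proof. by move=> h; apply/ffunP. Qed.

Lemma dotp_lin a r u v : dotp a (r *: u + v) = r * dotp a u + dotp a v.
Proof.
rewrite /dotp mulr_sumr -big_split /=; apply: eq_bigr => x _.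
by rewrite addvE scalevE; ring.
Qed.

Lemma dotp0 a : dotp a 0 = 0.
Proof. by rewrite /dotp big1 // => x _; rewrite zerovE mulr0. Qed.

Lemma dotpZ a r u : dotp a (r *: u) = r * dotp a u.
Proof. by rewrite -[r *: u]addr0 dotp_lin dotp0 addr0. Qed.

Lemma dotpD a u v : dotp a (u + v) = dotp a u + dotp a v.
Proof. by rewrite -[u]scale1r dotp_lin scale1r mul1r. Qed.

Lemma dotpB a u v : dotp a (u - v) = dotp a u - dotp a v.
Proof. by rewrite dotpD -scaleN1r dotpZ mulN1r. Qed.

Lemma dotpC a u : dotp a u = dotp u a.
Proof. by apply: eq_bigr => x _; rewrite mulrC. Qed.

Lemma tv_norm0 : tv_norm (0 : vec R X) = 0.
Proof. by rewrite /tv_norm big1 ?mulr0 // => x _; rewrite zerovE normr0. Qed.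

Lemma tv_norm_ge0 u : 0 <= tv_norm u.
Proof. by rewrite mulr_ge0 ?invr_ge0 ?ler0n // sumr_ge0. Qed.

Lemma tv_normZ r u : tv_norm (r *: u) = `|r| * tv_norm u.
Proof.
rewrite /tv_norm mulrCA; congr (_ * _); rewrite mulr_sumr.
by apply: eq_bigr => x _; rewrite scalevE normrM.
Qed.

Lemma tv_normD u v : tv_norm (u + v) <= tv_norm u + tv_norm v.
Proof.
rewrite /tv_norm -mulrDr ler_wpM2l ?invr_ge0 ?ler0n // -big_split /=.
by apply: ler_sum => x _; rewrite addvE ler_normD.
Qed.

Lemma tv_norm_ge u x : `|u x : R| <= 2 * tv_norm u.
Proof.
rewrite /tv_norm mulVKf ?pnatr_eq0 // (bigD1 x) //= lerDl.
by apply: sumr_ge0.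
Qed.

Lemma tv_norm_gt0 u : u != 0 -> 0 < tv_norm u.
Proof.
move=> u0; rewrite lt_def tv_norm_ge0 andbT; apply: contraNneq u0 => tv0.
apply/eqP/vecP => x; rewrite zerovE; apply/eqP; rewrite -normr_le0.
by rewrite (le_trans (tv_norm_ge u x)) // tv0 mulr0.
Qed.

Lemma sum0_neg u : \sum_x (u x : R) = 0 -> u != 0 -> exists x, (u x : R) < 0.
Proof.
move=> s0 u0; apply/not_existsP => h; move/negP: u0; apply.
have h' x : 0 <= (u x : R) by rewrite leNgt; apply/negP/h.
apply/eqP/vecP => x; rewrite zerovE; move/eqP: s0.
by rewrite psumr_eq0 // => /allP /(_ x (mem_index_enum x)) /eqP.
Qed.

End VectorAlgebra.

(** * The ratio test *)

Section RatioTest.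
Variables (R : realFieldType) (X : finType).

(** The step length is the smallest ratio [u x / - d x] over the decreasing
    coordinates; a coordinate attaining it is the one that vanishes. *)
Lemma ratio_test (A : {pred X}) (u d : X -> R) :
    (forall x, x \in A -> 0 <= u x) ->
    (forall x, x \in A -> u x = 0 -> 0 <= d x) ->
    (exists2 x, x \in A & d x < 0) ->
  exists s : R, [/\ 0 < s, forall x, x \in A -> 0 <= u x + s * d x &
    exists x, [/\ x \in A, d x < 0 & u x + s * d x = 0]].
Proof.
move=> u0 d0 [x0 Ax0 dx0].
pose B x := (x \in A) && (d x < 0).
have Bx0 : B x0 by rewrite /B Ax0.
case: (@arg_minP _ _ _ x0 B (fun x => u x / - d x) Bx0) => x1 /andP[Ax1 dx1] m.
have nd1 : 0 < - d x1 by rewrite oppr_gt0.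
have u1 : 0 < u x1.
  rewrite lt_def u0 // andbT; apply/negP => /eqP /(d0 _ Ax1).
  by rewrite leNgt dx1.
exists (u x1 / - d x1); split; first by rewrite divr_gt0.
- move=> x Ax; have [dx|dx] := ltP (d x) 0; last first.
    by rewrite addr_ge0 ?u0 // mulr_ge0 // ltW // divr_gt0.
  have := m x; rewrite /B Ax dx => /(_ isT).
  by rewrite ler_pdivlMr ?oppr_gt0 // mulrN lerNl -subr_ge0 opprK addrC.
- exists x1; split => //; field.
  by move: dx1; rewrite lt_neqAle => /andP[].
Qed.

End RatioTest.

(** * Affine sets and tangent spaces *)

Section Affine.
Variables (R : realType) (X : finType).
Implicit Types (A S : set (vec R X)) (p q u v : vec R X) (r : R).

Lemma affine_hull_affine S : affine_set (affine_hull S).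
Proof.
by move=> p q r hp hq A AS; apply: AS.1; [exact: hp|exact: hq].
Qed.

Lemma sub_affine_hull S : S `<=` affine_hull S.
Proof. by move=> p Sp A [_]; apply. Qed.

Lemma affine_hull_min S A : affine_set A -> S `<=` A -> affine_hull S `<=` A.
Proof. by move=> hA SA p; apply; split. Qed.

(** The point is the midpoint of a point of the line [p q'] and one of the line
    [p q]. *)
Lemma affine_add A p q q' r :
  affine_set A -> A p -> A q -> A q' -> A (p + r *: (q' - q)).
Proof.
move=> hA Ap Aq Aq'.
have -> : p + r *: (q' - q) =
    (1 - 2^-1) *: ((1 - 2 * r) *: p + (2 * r) *: q') +
    2^-1 *: ((1 - - (2 * r)) *: p + (- (2 * r)) *: q).
  by apply: vecP => x; rewrite !(addvE, scalevE, oppvE); field.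
by apply: (hA); apply: (hA).
Qed.

Lemma tangent_lin S u v r :
  tangent_space S u -> tangent_space S v -> tangent_space S (r *: u + v).
Proof.
move=> [p [q [hp hq ->]]] [p' [q' [hp' hq' ->]]].
exists p', (q' + r *: (q - p)); split=> //.
  exact: affine_add (@affine_hull_affine S) _ _ _.
by rewrite addrAC addrC.
Qed.

Lemma tangentB S p q : S p -> S q -> tangent_space S (q - p).
Proof. by move=> Sp Sq; exists p, q; split=> //; exact: sub_affine_hull. Qed.

Lemma tangent_hull S p v : S p -> tangent_space S v -> affine_hull S (p + v).
Proof.
move=> Sp [q [q' [hq hq' ->]]]; rewrite -[q' - q]scale1r.
exact: affine_add (@affine_hull_affine S) (sub_affine_hull Sp) hq hq'.
Qed.

Lemma tangent0 S v : tangent_space S v -> tangent_space S 0.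
Proof. by move=> h; have := tangent_lin (-1) h h; rewrite scaleN1r addNr. Qed.

Lemma tangentZ S v r : tangent_space S v -> tangent_space S (r *: v).
Proof.
by move=> h; rewrite -[_ *: _]addr0; apply: tangent_lin => //; exact: tangent0 h.
Qed.

Lemma tangentD S u v :
  tangent_space S u -> tangent_space S v -> tangent_space S (u + v).
Proof. by move=> hu hv; rewrite -[u]scale1r; apply: tangent_lin. Qed.

Lemma affine_level a r : affine_set [set v : vec R X | dotp a v = r].
Proof.
move=> u v s /= hu hv; rewrite dotp_lin dotpZ hu hv; ring.
Qed.

End Affine.

(** * Linear algebra of coordinate functions *)

(** By induction on [s], restricting [S] to the kernel of the first coordinate: the
    form obtained there differs from [dotp a] on [S] by a multiple of that
    coordinate, found at any vector where the coordinate does not vanish. *)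
Lemma coordinate_span (R : realType) (X : finType) (S : set (vec R X)) (s : seq X)
    (a : vec R X) :
    (forall r u v, S u -> S v -> S (r *: u + v)) ->
    (forall v, S v -> (forall x, x \in s -> v x = 0) -> dotp a v = 0) ->
  exists2 y : vec R X, forall x, x \notin s -> y x = 0 &
    forall v, S v -> dotp a v = dotp y v.
Proof.
elim: s S => [|x s IH] S Slin h.
  exists 0 => [x _|v Sv]; first exact: zerovE.
  by rewrite dotpC (dotpC 0) !dotp0 dotpC h.
have [] := IH (S `&` [set v | v x = 0]).
- move=> r u v [Su ux] [Sv vx]; split; first exact: Slin.
  by rewrite /= addvE scalevE ux vx mulr0 addr0.
- move=> v [Sv vx] hv; apply: h => // z; rewrite inE => /orP[/eqP->//|]; exact: hv.
move=> y ys hy.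
have [[t [St tx]]|nt] := pselect (exists t, S t /\ t x <> 0); last first.
  exists y => [z|v Sv]; first by rewrite inE negb_or => /andP[_]; exact: ys.
  by apply: hy; split=> //; apply: contrapT => vx; apply: nt; exists v.
have tx0 : (t x : R) != 0 by exact/eqP.
exists (y + ((dotp a t - dotp y t) / t x) *: basis_vec R x).
  move=> z; rewrite inE negb_or => /andP[zx zs].
  by rewrite addvE scalevE ys // /basis_vec ffunE (negPf zx) mulr0 addr0.
move=> v Sv.
have ex u : dotp (basis_vec R x) u = u x.
  rewrite /dotp (bigD1 x) //= big1 ?addr0 /basis_vec ?ffunE ?eqxx ?mul1r //.
  by move=> z zx; rewrite ffunE (negPf zx) mul0r.
have /hy : (S `&` [set v | v x = 0]) ((- (v x / t x : R)) *: t + v).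
  split; first exact: Slin.
  by rewrite /= addvE scalevE mulNr divfK // addNr.
rewrite !dotp_lin (dotpC (_ + _)) dotpD dotpZ !(dotpC v) ex.
move=> e; have -> : dotp a v = (- (v x / t x) * dotp y t + dotp y v)
  + v x / t x * dotp a t by rewrite -e; ring.
by field.
Qed.

(** The hyperplane is the kernel of the nonzero linear form [dotp e]. *)
Lemma has_dim_hyperplane (R : realType) (X : finType) (S : set (vec R X))
    (e : vec R X) :
  e != 0 -> tangent_space S = [set a | dotp a e = 0] -> has_dim S #|X|.-1.
Proof.
move=> e0 tS; pose phi (a : vec R X) : R^o := dotp e a.
have phi_lin : GRing.linear_for *:%R phi by move=> r u v; exact: dotp_lin.
pose phiL : {linear vec R X -> R^o} :=
  HB.pack phi (GRing.isLinear.Build _ _ _ _ phi phi_lin).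
pose F := linfun phiL; exists (lker F); last first.
  rewrite tS; apply/seteqP; split=> a /=;
    by rewrite memv_ker lfunE /= /phi dotpC => /eqP.
have := limg_ker_dim F fullv; rewrite capfv.
have -> : \dim (limg F) = 1%N.
  apply/eqP; rewrite eqn_leq (leq_trans (dimvS (subvf _))) ?dimvf //=.
  rewrite lt0n dimv_eq0; apply: contraNneq e0 => F0.
  have : F e \in limg F by rewrite memv_img // memvf.
  rewrite F0 memv0 lfunE /= /phi => /eqP ee; apply/eqP/vecP => x.
  rewrite zerovE; apply/eqP; move/eqP: ee; rewrite /dotp psumr_eq0.
    by move=> /allP /(_ x (mem_index_enum x)); rewrite mulf_eq0 orbb.
  by move=> y _; rewrite -expr2 sqr_ge0.
by rewrite dimvf /dim /= muln1 addn1 => <-.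
Qed.

Lemma finite_is_min (R : realType) (S : set R) :
  finite_set S -> S !=set0 -> exists m, is_min S m.
Proof.
move=> /finite_seqP[s ->]; elim: s => [[x]//|x s IH] _.
have [/IH[m [ms mlb]]|s0] := pselect ([set` s] !=set0); last first.
  exists x; split=> [|y]; rewrite /= inE ?eqxx // => /orP[/eqP->//|ys].
  by case: s0; exists y.
exists (Num.min x m); split=> [|y]; rewrite /= inE.
  by case: leP; rewrite ?eqxx // ms orbT.
move=> /orP[/eqP->|/mlb my]; first by rewrite ge_min lexx.
by rewrite ge_min my orbT.
Qed.

(** * Vertices and edges of a slice of the simplex *)

Section Polytope.
Variables (R : realType) (X : finType) (L : set (vec R X)).
Hypothesis affL : affine_set L.
Implicit Types (a c d e f mu nu v w : vec R X) (r : R).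

Let P := simplex R X `&` L.
Let T := tangent_space P.

Lemma simplex_ge0 mu x : P mu -> 0 <= (mu x : R).
Proof. by case=> -[]. Qed.

Lemma simplex_sum1 mu : P mu -> \sum_x (mu x : R) = 1.
Proof. by case=> -[]. Qed.

Lemma simplex_le1 mu x : P mu -> (mu x : R) <= 1.
Proof.
move=> Pmu; rewrite -(simplex_sum1 Pmu) (bigD1 x) //= lerDl.
by apply: sumr_ge0 => y _; exact: simplex_ge0.
Qed.

Lemma simplex_dotp1 mu : \sum_x (mu x : R) = dotp [ffun=> 1] mu.
Proof. by apply: eq_bigr => x _; rewrite ffunE mul1r. Qed.

Lemma hull_sub mu : affine_hull P mu -> L mu /\ \sum_x (mu x : R) = 1.
Proof.
move=> h; split; first by apply: affine_hull_min h => // ? [].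
rewrite simplex_dotp1; pose A := [set v : vec R X | dotp [ffun=> 1] v = 1].
apply: (@affine_hull_min _ _ P A) => //; first exact: affine_level.
by move=> v Pv; rewrite /A /= -simplex_dotp1 simplex_sum1.
Qed.

Lemma tangent_sum0 v : T v -> \sum_x (v x : R) = 0.
Proof.
move=> [p [q [/hull_sub[_ hp] /hull_sub[_ hq] ->]]].
by rewrite simplex_dotp1 dotpB -!simplex_dotp1 hp hq subrr.
Qed.

Lemma shift_mem mu v :
  P mu -> T v -> (forall x, 0 <= (mu x : R) + v x) -> P (mu + v).
Proof.
move=> Pmu Tv h; have [Lv s1] := hull_sub (tangent_hull Pmu Tv).
by split=> //; split=> // x; rewrite addvE.
Qed.

(** Basic feasible solutions: the linear-programming form of a vertex, which
    can be tested on supports alone. *)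
Definition basic nu : Prop :=
  P nu /\ forall d, T d -> (forall x, nu x = 0 -> d x = 0) -> d = 0.

(** The objective is minus the mass off the support of [nu]. *)
Lemma basic_vert nu : basic nu -> vert P nu.
Proof.
move=> [Pnu h]; pose a : vec R X := [ffun x => - (nu x == 0)%:R].
have aE mu : dotp a mu = - \sum_(x | nu x == 0) (mu x : R).
  rewrite /dotp [in RHS]big_mkcond /= -sumrN; apply: eq_bigr => x _.
  by rewrite ffunE; case: eqP => _; rewrite ?mulN1r ?oppr0 ?mul0r.
have anu : dotp a nu = 0 by rewrite aE big1 ?oppr0 // => x /eqP.
have le0 mu : P mu -> dotp a mu <= 0.
  by move=> Pmu; rewrite aE oppr_le0 sumr_ge0 // => x _; exact: simplex_ge0.
exists a; apply/seteqP; split=> [mu [Pmu m]|_ ->] /=; last first.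
  by split=> // mu Pmu; rewrite anu le0.
apply/eqP; rewrite -subr_eq0; apply/eqP/h; first exact: tangentB.
move=> x nux; rewrite addvE oppvE nux subr0; apply/eqP.
have: dotp a mu == 0 by rewrite eq_le le0 //= -anu m.
rewrite aE oppr_eq0 psumr_eq0 => [/allP/(_ x (mem_index_enum x))|y _].
  by rewrite nux eqxx.
exact: simplex_ge0.
Qed.

(** A point of minimal support in a face is basic: along a tangent direction
    supported in its support one can move both ways without leaving the face, until a
    coordinate vanishes. *)
Lemma exists_basic c mu : argmax_face P c mu ->
  exists2 nu, argmax_face P c nu & basic nu.
Proof.
have [n] := ubnP #|[set x | mu x != 0]%SET|.
elim: n mu => // n IH mu lt_n [Pmu m].
have [bmu|nbmu] := pselect (basic mu); first by exists mu.
have [d Td [dsub d0]] : exists2 d, T d & (forall x, mu x = 0 -> d x = 0) /\ d <> 0.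
  apply: contrapT => h; apply: nbmu; split=> // d Td dsub.
  by apply: contrapT => d0; apply: h; exists d.
have cd0 u : T u -> (forall x, mu x = 0 -> u x = 0) -> u != 0 -> dotp c u <= 0.
  move=> Tu usub u0.
  have [x ux] := sum0_neg (tangent_sum0 Tu) u0.
  have [|||s [s0 h _]] := @ratio_test R X predT mu u.
  - by move=> y _; exact: simplex_ge0.
  - by move=> y _ /usub ->.
  - by exists x.
  have := m (mu + s *: u); rewrite dotpD dotpZ gerDl pmulr_rle0 //; apply.
  apply: shift_mem => // [|y]; first exact: tangentZ.
  by rewrite scalevE h.
have cd : dotp c d = 0.
  apply/eqP; rewrite eq_le cd0 //=; last exact/eqP.
  rewrite -oppr_le0 -mulN1r -dotpZ cd0 //; first exact: tangentZ.
  - by move=> x /dsub h; rewrite scalevE h mulr0.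
  - by rewrite scaleN1r oppr_eq0; apply/eqP.
have [|x dx] := sum0_neg (tangent_sum0 Td); first exact/eqP.
have [|||s [s0 h [x1 [_ dx1 hx1]]]] := @ratio_test R X predT mu d.
- by move=> y _; exact: simplex_ge0.
- by move=> y _ /dsub ->.
- by exists x.
have Pmu' : P (mu + s *: d).
  apply: shift_mem => // [|y]; first exact: tangentZ.
  by rewrite scalevE h.
apply: (IH (mu + s *: d)); last first.
  by split=> // nu Pnu; rewrite dotpD dotpZ cd mulr0 addr0 m.
rewrite -ltnS; apply: leq_trans lt_n; rewrite ltnS; apply: proper_card.
apply/properP; split.
  apply/fintype.subsetP => y; rewrite !inE addvE scalevE; apply: contraNN => /eqP my.
  by rewrite my dsub // mulr0 addr0.
exists x1; rewrite !inE ?addvE ?scalevE ?hx1 ?eqxx //.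
by apply: contraTN dx1 => /eqP /dsub ->; rewrite ltxx.
Qed.

(** The tangent cone of [P] at [nu]. *)
Definition feasible_dir nu d : Prop :=
  T d /\ forall x, nu x = 0 -> 0 <= (d x : R).

(** Rays of the tangent cone cut out by the inequalities tight along them. *)
Definition extremal nu e : Prop :=
  [/\ feasible_dir nu e, e <> 0 &
    forall f, T f -> (forall x, nu x = 0 -> e x = 0 -> f x = 0) ->
      exists r, f = r *: e].

(* The constraints tight at [nu] that moving along [d] relaxes; its cardinal is the
   measure of the two inductions below. *)
Let slack nu d := [set x | (nu x == 0) && (d x != 0)]%SET.

Lemma feasible_dirB nu mu : P nu -> P mu -> feasible_dir nu (mu - nu).
Proof.
move=> Pnu Pmu; split=> [|x nux]; first exact: tangentB.
by rewrite addvE oppvE nux subr0 simplex_ge0.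
Qed.

(** Following an extreme ray until a coordinate vanishes leads to a neighbor.
    Of the vectors [a] for which both endpoints are optimal, those of the form
    (normal to [T]) - (nonnegative combination of the coordinates vanishing at both
    endpoints) already span the orthogonal complement of [e]. *)
Lemma extremal_neighbor nu e : basic nu -> extremal nu e ->
  exists2 s : R, 0 < s & neighbors P nu (nu + s *: e).
Proof.
move=> bnu [[Te e_ge0] e0 ext]; have [Pnu hnu] := bnu.
have [|x ex] := sum0_neg (tangent_sum0 Te); first exact/eqP.
have [|||s [s0 h [x1 [_ ex1 hx1]]]] := @ratio_test R X predT nu e.
- by move=> y _; exact: simplex_ge0.
- by move=> y _ /e_ge0.
- by exists x.
set w := nu + s *: e.
have Pw : P w.
  by apply: shift_mem => // [|y]; [exact: tangentZ|rewrite scalevE h].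
have wE y : w y = nu y + s * e y by rewrite addvE scalevE.
have bw : basic w.
  split=> // f Tf fw; have [|r fE] := ext f Tf.
    by move=> y nuy ey; apply: fw; rewrite wE nuy ey mulr0 addr0.
  have := fw x1; rewrite wE hx1 fE scalevE => /(_ erefl) /eqP.
  by rewrite mulf_eq0 (lt_eqF ex1) orbF => /eqP ->; rewrite scale0r.
exists s => //; split; [exact: basic_vert|exact: basic_vert|].
apply: (@has_dim_hyperplane _ _ _ e); first exact/eqP.
set N := [set a | _ /\ _].
have Ne a : N a -> dotp a e = 0.
  move=> [[_ m1] [_ m2]].
  have /eqP : dotp a w = dotp a nu by apply/eqP; rewrite eq_le m1 ?m2.
  by rewrite dotpD dotpZ -subr_eq0 addrAC subrr add0r mulf_eq0 (gt_eqF s0) => /eqP.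
apply/seteqP; split=> [a [a1 [a2 [ha1 ha2 ->]]]|a /= ae].
  have he b : affine_hull N b -> dotp b e = 0.
    move=> hb; pose A := [set b : vec R X | dotp e b = 0].
    rewrite dotpC; apply: (@affine_hull_min _ _ N A) hb; first exact: affine_level.
    by move=> b' /Ne; rewrite /A /= dotpC.
  by rewrite /= dotpC dotpB !(dotpC e) !he // subrr.
pose Z := [seq x <- enum X | (nu x == 0) && (e x == 0)].
have ZP y : (y \in Z) = (nu y == 0) && (e y == 0).
  by rewrite mem_filter mem_enum andbT.
have [||y yZ hy] := @coordinate_span R X T Z a.
- by move=> r u v; exact: tangent_lin.
- move=> v Tv hv; have [|r ->] := ext v Tv.
    by move=> z nuz ez; apply: hv; rewrite ZP nuz ez !eqxx.
  by rewrite dotpZ ae mulr0.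
have NP b (z : vec R X) : (forall x, 0 <= (z x : R)) ->
    (forall x, x \notin Z -> z x = 0) ->
    (forall v, T v -> dotp b v = - dotp z v) -> N b.
  move=> z_ge0 zZ bz.
  (* Complementary slackness. *)
  have key q : P q -> (forall x, x \in Z -> q x = 0) -> argmax_face P b q.
    move=> Pq qZ; split=> // u Pu; rewrite -subr_le0 -dotpB bz; last exact: tangentB.
    rewrite oppr_le0; apply: sumr_ge0 => i _; rewrite addvE oppvE.
    have [iZ|/zZ->] := boolP (i \in Z); last by rewrite mul0r.
    by rewrite qZ // subr0 mulr_ge0 // simplex_ge0.
  split; apply: key => // i; rewrite ZP => /andP[/eqP nui /eqP ei] //.
  by rewrite wE nui ei mulr0 addr0.
pose yp : vec R X := [ffun x => Num.max (y x) 0].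
pose ym : vec R X := [ffun x => Num.max (- y x) 0].
exists (- yp), (a - y - ym); split.
- apply: sub_affine_hull; apply: (NP _ yp).
  + by move=> i; rewrite ffunE le_max lexx orbT.
  + by move=> i /yZ yi; rewrite ffunE yi maxxx.
  + by move=> v Tv; rewrite dotpC -scaleN1r dotpZ mulN1r dotpC.
- apply: sub_affine_hull; apply: (NP _ ym).
  + by move=> i; rewrite ffunE le_max lexx orbT.
  + by move=> i /yZ yi; rewrite ffunE yi oppr0 maxxx.
  + by move=> v Tv; rewrite dotpC !dotpB !(dotpC v) hy // subrr sub0r.
- apply: vecP => i; rewrite !(addvE, oppvE) !ffunE.
  case: (leP (y i : R) 0) => yi; case: (leP (- y i : R) 0) => yi'; lra.
Qed.

(** As long as [d] is not extremal, some tangent [f], tight wherever [d] is, is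
    not a multiple of [d]; moving from [d] along [f] or [- f] keeps feasibility
    until one more constraint becomes tight. *)
Lemma exists_extremal nu d : basic nu -> feasible_dir nu d -> d <> 0 ->
  exists2 e, extremal nu e & forall x, nu x = 0 -> d x = 0 -> e x = 0.
Proof.
move=> [Pnu hnu]; have [n] := ubnP #|slack nu d|.
elim: n d => // n IH d lt_n [Td d_ge0] d0.
have [|] := pselect (extremal nu d); first by exists d.
move=> next; have [f [Tf fsub nf]] : exists f, [/\ T f,
    forall x, nu x = 0 -> d x = 0 -> f x = 0 & ~ exists r, f = r *: d].
  apply: contrapT => h; apply: next; split=> // f Tf fsub.
  by apply: contrapT => nr; apply: h; exists f.
wlog [x nux fx] : f Tf fsub nf / exists2 x, nu x = 0 & (f x : R) < 0.
  move=> wl; have [x [nux fx]] : exists x, nu x = 0 /\ f x <> 0.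
    apply: contrapT => h; apply: nf; exists 0; rewrite scale0r; apply: hnu => // x nux.
    by apply: contrapT => fx; apply: h; exists x.
  have [fx0|fx0] := ltP (f x : R) 0; first by apply: (wl f) => //; exists x.
  apply: (wl (- f)).
  - by rewrite -scaleN1r; exact: tangentZ.
  - by move=> y nuy dy; rewrite oppvE fsub // oppr0.
  - by move=> [r fr]; apply: nf; exists (- r); rewrite scaleNr -fr opprK.
  - by exists x => //; rewrite oppvE oppr_lt0 lt_def fx0 andbT; apply/eqP.
pose A := [pred x | nu x == 0].
have [|||s [s0 h [x1 [/eqP nux1 fx1 hx1]]]] := @ratio_test R X A d f.
- by move=> y /eqP; exact: d_ge0.
- by move=> y /eqP nuy dy; rewrite fsub.
- by exists x => //; apply/eqP.
have [|||e ee sub] := IH (d + s *: f).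
- apply: leq_trans (_ : #|slack nu d| <= n)%N => //; apply: proper_card.
  apply/properP; split.
    apply/fintype.subsetP => y; rewrite !inE addvE scalevE => /andP[nuy].
    rewrite nuy; apply: contraNN => /eqP dy.
    by rewrite dy fsub ?mulr0 ?addr0 //; apply/eqP.
  exists x1; rewrite !inE ?addvE ?scalevE ?hx1 nux1 !eqxx //=.
  by apply: contraTN fx1 => /eqP dx1; rewrite fsub // ltxx.
- split=> [|y /eqP nuy]; first by apply: tangentD => //; exact: tangentZ.
  by rewrite addvE scalevE h.
- move=> /eqP; rewrite addrC addr_eq0 => /eqP sf; apply: nf; exists (- s^-1).
  by rewrite scaleNr -scalerN -sf scalerA mulVf ?scale1r // gt_eqF.
exists e => // y nuy dy; apply: sub => //.
by rewrite addvE scalevE dy fsub // mulr0 addr0.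
Qed.

(** The tangent cone at a basic point is generated by the edges to its
    neighbors: subtracting from a feasible direction the right multiple of an
    extreme ray makes one more coordinate vanish. *)
Lemma edge_cone_ind nu (Q : vec R X -> Prop) : basic nu -> Q 0 ->
    (forall d w r, 0 <= r -> neighbors P nu w -> Q d -> Q (d + r *: (w - nu))) ->
  forall d, feasible_dir nu d -> Q d.
Proof.
move=> bnu Q0 Qadd d; have [n] := ubnP #|slack nu d|.
elim: n d => // n IH d lt_n fd.
have [->//|/eqP d0] := eqVneq d 0.
have [e ee sub] := exists_extremal bnu fd d0.
have [s s0 nw] := extremal_neighbor bnu ee.
have [[Te e_ge0] e0 _] := ee; have [Td d_ge0] := fd.
have [x [nux ex]] : exists x, nu x = 0 /\ e x <> 0.
  apply: contrapT => h; apply: e0; apply: bnu.2 => // x nux.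
  by apply: contrapT => ex; apply: h; exists x.
pose A := [pred x | nu x == 0].
have [|||r [r0 h [x1 [/eqP nux1 ex1 hx1]]]] := @ratio_test R X A d (fun x => - e x).
- by move=> y /eqP; exact: d_ge0.
- by move=> y /eqP nuy dy; rewrite sub // oppr0.
- exists x; first exact/eqP.
  by rewrite oppr_lt0 lt_def e_ge0 // andbT; apply/eqP.
have -> : d = d - r *: e + (r / s) *: (nu + s *: e - nu).
  by rewrite (addrC nu) addrK scalerA divfK ?subrK // gt_eqF.
have dE y : (d - r *: e) y = d y + r * - e y.
  by rewrite addvE oppvE scalevE mulrN.
apply: Qadd => //; first by rewrite divr_ge0 // ltW.
apply: IH; last first.
  split=> [|y /eqP nuy]; last by rewrite dE h.
  by rewrite addrC -scaleNr; apply: tangentD => //; exact: tangentZ.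
apply: leq_trans (_ : #|slack nu d| <= n)%N => //; apply: proper_card.
apply/properP; split.
  apply/fintype.subsetP => y; rewrite !inE dE => /andP[nuy].
  rewrite nuy; apply: contraNN => /eqP dy.
  by rewrite dy sub ?oppr0 ?mulr0 ?addr0 //; apply/eqP.
exists x1; rewrite !inE ?dE ?hx1 nux1 !eqxx //=.
by apply: contraTN ex1 => /eqP dx1; rewrite sub // oppr0 ltxx.
Qed.

(** Otherwise the segment from [mu] to [nu] could be prolonged beyond [nu] inside
    [P], and [nu] would not be the only maximizer of its objective. *)
Lemma vert_supp nu mu : vert P nu -> P mu ->
  (forall x, nu x = 0 -> mu x = 0) -> mu = nu.
Proof.
move=> [a va] Pmu sub.
have [Pnu m] : argmax_face P a nu by rewrite va.
have [//|munu] := eqVneq mu nu.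
have Td : T (nu - mu) by exact: tangentB.
have d0 : nu - mu != 0 by rewrite subr_eq0 eq_sym.
have [x dx] := sum0_neg (tangent_sum0 Td) d0.
have [|||s [s0 h _]] := @ratio_test R X predT nu (nu - mu).
- by move=> y _; exact: simplex_ge0.
- by move=> y _ nuy; rewrite addvE oppvE nuy sub // subrr.
- by exists x.
have : dotp a (nu + s *: (nu - mu)) <= dotp a nu.
  apply: m; apply: shift_mem => // [|y]; first exact: tangentZ.
  by rewrite scalevE h.
rewrite dotpD dotpZ gerDl pmulr_rle0 // dotpB subr_le0 => le_a.
have : argmax_face P a mu by split=> // q /m /le_trans; apply.
by rewrite va.
Qed.

Lemma vert_mem nu : vert P nu -> P nu.
Proof. by case=> a aE; have [] : argmax_face P a nu by rewrite aE. Qed.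

(** Vertices are determined by their zero sets, of which there are finitely many. *)
Lemma finite_vert : finite_set (vert P).
Proof.
pose zeros (mu : vec R X) := [set x | mu x == 0]%SET.
pose pick (A : {set X}) : vec R X := xget 0 [set mu | vert P mu /\ zeros mu = A].
apply: (@sub_finite_set _ _ [set pick A | A in setT]); last exact: finite_image.
move=> mu vmu; exists (zeros mu) => //; rewrite /pick.
case: xgetP => [q _ [vq /setP zq]|/(_ mu)[]//].
apply: vert_supp => // [|x mux]; first exact: vert_mem.
by have := zq x; rewrite !inE mux eqxx => /eqP.
Qed.

Lemma finite_slopes c : finite_set (slopes P c).
Proof.
pose h (nu mu : vec R X) : R := (dotp c nu - dotp c mu) / tv_norm (nu - mu).
apply: (@sub_finite_set _ _ [set h nu mu | nu in vert P & mu in vert P]).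
  by move=> r [nu [mu [_ [vnu vmu _] _ ->]]]; exists nu => //; exists mu.
exact: finite_image2 finite_vert finite_vert.
Qed.

Lemma slopes_gt0 c r : slopes P c r -> 0 < r.
Proof.
move=> [nu [mu [vnu [_ /vert_mem Pmu _] Fmu ->]]].
have [Pnu m] : argmax_face P c nu.
  by case: vnu => a aE; have [] : argmax_face (argmax_face P c) a nu by rewrite aE.
rewrite divr_gt0 //; last first.
  by rewrite tv_norm_gt0 // subr_eq0; apply/eqP => numu; apply: Fmu; rewrite -numu.
rewrite subr_gt0 ltNge; apply/negP => le_c; apply: Fmu; split=> // q /m.
by move=> /le_trans; apply.
Qed.

Lemma basic_vert_face c nu :
  basic nu -> argmax_face P c nu -> vert (argmax_face P c) nu.
Proof.
move=> /basic_vert[a aE] Fnu; exists a.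
have [Pnu m] : argmax_face P a nu by rewrite aE.
apply/seteqP; split=> [q [Fq mq]|_ ->] /=; last by split=> // q [] /m.
have : argmax_face P a q by split=> [|u /m /le_trans]; [exact: Fq.1|apply; exact: mq].
by rewrite aE.
Qed.

(** If every edge at an optimal vertex stayed in the optimal face, the objective
    would be constant on the cone they generate, hence on [P]. *)
Lemma slopes_neq0 c nu mu : argmax_face P c nu -> P mu -> ~ argmax_face P c mu ->
  slopes P c !=set0.
Proof.
move=> /exists_basic[{}nu Fnu bnu] Pmu Fmu; have [Pnu m] := Fnu.
apply: contrapT => no; apply: Fmu; split=> // q /m.
suff : 0 <= dotp c (mu - nu) by rewrite dotpB subr_ge0 => h /le_trans; apply.
apply: (edge_cone_ind (nu := nu) (Q := fun d => 0 <= dotp c d)) => //.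
- by rewrite dotp0.
- move=> d w r r0 nw cd; rewrite dotpD dotpZ addr_ge0 // mulr_ge0 //.
  rewrite dotpB subr_ge0; have [[_ mw]|Fw] := pselect (argmax_face P c w).
    exact: mw.
  case: no; exists ((dotp c nu - dotp c w) / tv_norm (nu - w)), nu, w.
  by split=> //; exact: basic_vert_face.
- exact: feasible_dirB.
Qed.

(** Discarding, in an edge decomposition of [mu - nu], the edges that leave the
    optimal face moves [mu] to a point [n] of its affine hull, at a distance
    controlled by the loss in objective. *)
Lemma optimal_part c D nu mu :
    basic nu -> argmax_face P c nu -> 0 <= D -> lbound (slopes P c) D -> P mu ->
  exists n, [/\ T (n - mu), dotp c n = dotp c nu,
    forall x, (forall q, argmax_face P c q -> q x = 0) -> n x = 0 &
    D * tv_norm (n - mu) <= dotp c nu - dotp c mu].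
Proof.
move=> bnu Fnu D0 Dlb Pmu; have [Pnu m] := Fnu.
pose Q d := exists a b, [/\ d = a + b, T b, dotp c a = 0,
  forall x, (forall q, argmax_face P c q -> q x = 0) -> a x = 0 &
  D * tv_norm b <= - dotp c b].
have [a [b [dE Tb ca aF Db]]] : Q (mu - nu).
  apply: (edge_cone_ind bnu).
  - exists 0, 0; split; rewrite ?addr0 ?dotp0 ?tv_norm0 ?mulr0 ?oppr0 //.
      exact: tangent0 (tangentB Pnu Pmu).
    by move=> x _; rewrite zerovE.
  - move=> d w r r0 nw [a [b [-> Tb ca aF Db]]].
    have Pw : P w by case: nw => _ /vert_mem.
    have [Fw|Fw] := pselect (argmax_face P c w).
      exists (a + r *: (w - nu)), b; split=> //; first by rewrite addrAC.
        have -> : dotp c (a + r *: (w - nu)) = r * (dotp c w - dotp c nu).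
          by rewrite dotpD ca dotpZ dotpB add0r.
        suff -> : dotp c w = dotp c nu by rewrite subrr mulr0.
        by apply/eqP; rewrite eq_le m //= Fw.2.
      move=> x hx; rewrite addvE aF // scalevE addvE oppvE hx // hx //.
      by rewrite subrr mulr0 addr0.
    exists a, (b + r *: (w - nu)); split; rewrite ?addrA //.
      by apply: tangentD => //; apply: tangentZ; exact: tangentB.
    apply: le_trans (_ : D * (tv_norm b + r * tv_norm (w - nu)) <= _).
      rewrite ler_wpM2l // (le_trans (tv_normD _ _)) // tv_normZ ger0_norm //.
    have : D * tv_norm (w - nu) <= - dotp c (w - nu).
      have -> : w - nu = (-1 : R) *: (nu - w) by rewrite scaleN1r opprB.
      rewrite tv_normZ normrN1 mul1r dotpZ mulN1r opprK dotpB -ler_pdivlMr.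
        apply: Dlb; exists nu, w; split=> //; exact: basic_vert_face.
      by rewrite tv_norm_gt0 // subr_eq0; apply/eqP => nuw; apply: Fw; rewrite -nuw.
    move=> /(ler_wpM2l r0); rewrite (dotpD c b) dotpZ; lra.
  - exact: feasible_dirB.
have muE : mu = nu + a + b by rewrite -addrA -dE addrC subrK.
have nE : nu + a - mu = (-1 : R) *: b.
  by rewrite muE scaleN1r opprD addrA subrr add0r.
exists (nu + a); split.
- by rewrite nE; exact: tangentZ.
- by rewrite dotpD ca addr0.
- by move=> x hx; rewrite addvE aF // hx // addr0.
- by rewrite nE tv_normZ normrN1 mul1r muE !dotpD ca; lra.
Qed.

End Polytope.

(** * One-sided derivatives and monotonicity *)

Section Calculus.
Variable R : realType.
Implicit Types (f g df : R -> R) (t l : R).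

Lemma is_derive1_continuous f t l : is_derive t 1 f l -> {for t, continuous f}.
Proof.
by move=> [h _]; apply: differentiable_continuous; exact/derivable1_diffP.
Qed.

Lemma le_of_derive_le0 f df (a b : R) : a <= b ->
    (forall t, a < t <= b -> is_derive t 1 f (df t)) ->
    f t @[t --> a^'+] --> f a ->
    (forall t, a < t < b -> df t <= 0) ->
  f b <= f a.
Proof.
rewrite le_eqVlt => /orP[/eqP->//|ab] fd fa df0.
have [||t] := @MVT R f df a b ab.
- by move=> t; rewrite in_itv /= => /andP[at_ tb]; apply: fd; rewrite at_ ltW.
- apply/continuous_within_itvP => //; split=> //.
    move=> x; rewrite in_itv /= => /andP[ax xb].
    by apply: is_derive1_continuous (fd x _); rewrite ax ltW.
  by apply: cvg_at_left_filter; apply: is_derive1_continuous (fd b _); rewrite ab lexx.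
move=> tab fE; rewrite -subr_le0 fE; apply: mulr_le0_ge0; last by rewrite subr_ge0 ltW.
by apply: df0; move: tab; rewrite in_itv.
Qed.

Lemma is_derive1_sum (X : finType) (f : X -> R -> R) (df : X -> R) t :
  (forall x, is_derive t 1 (f x) (df x)) ->
  is_derive t 1 (fun s => \sum_x f x s) (\sum_x df x).
Proof.
move=> h; have -> : (fun s => \sum_x f x s) = \sum_x f x by rewrite fct_sumE.
by elim/big_ind2 : _ => // [|u1 u2 v1 v2 *]; [exact: is_derive_cst|exact: is_deriveD].
Qed.

Lemma cvg_finsum (X : finType) (F : set_system R) {FF : Filter F}
    (f : X -> R -> R) (l : X -> R) :
  (forall x, f x s @[s --> F] --> l x) ->
  (\sum_x f x s) @[s --> F] --> \sum_x l x.
Proof.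
move=> h; have -> : (fun s => \sum_x f x s) = \sum_x f x by rewrite fct_sumE.
by elim/big_ind2 : _ => // [|u1 u2 v1 v2 *]; [exact: cvg_cst|exact: cvgD].
Qed.

(* Difference quotients restricted to nonnegative times: two-sided derivatives are
   available only at positive times, right continuity also at the origin. *)
Section TimeDomain.
Variables (f : R -> R) (t l : R).
Hypothesis fq : ((f s - f t) / (s - t)) @[s --> within [set s : R | 0 <= s] t^'] --> l.

Lemma is_derive_within_nonneg : 0 < t -> is_derive t 1 f l.
Proof.
move=> t0; apply/is_derive1_caratheodory.
exists (fun s => if s == t then l else (f s - f t) / (s - t)); split.
- move=> z; case: eqP => [->|/eqP]; first by rewrite !subrr mulr0.
  by rewrite -subr_eq0 => /divfK->.
- apply/continuous_withinNx; rewrite eqxx; apply: cvg_trans fq.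
  apply: (@cvg_trans _ ((f s - f t) / (s - t) @[s --> t^'])).
    apply: near_eq_cvg; near=> s; rewrite ifN //.
    by near: s; exact: nbhs_dnbhs_neq.
  apply: cvg_app => A /= At; rewrite /within /= in At.
  have s_ge0 : \forall s \near t^', 0 <= s.
    by apply: nbhs_dnbhs; near=> s; apply: ltW; near: s; exact: lt_nbhsr.
  by apply: filterS2 s_ge0 At => s s0; apply.
- by rewrite eqxx.
Unshelve. all: by end_near. Qed.

Lemma right_continuous_within_nonneg : 0 <= t -> f s @[s --> t^'+] --> f t.
Proof.
move=> t0.
have fq' : ((f s - f t) / (s - t)) @[s --> t^'+] --> l.
  apply: cvg_trans fq; apply: cvg_app => A /= [e e0 Ae]; exists e => //= s se ts.
  by apply: Ae => //; [rewrite gt_eqF|exact: ltW (le_lt_trans t0 ts)].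
have -> : f t = l * (t - t) + f t by rewrite subrr mulr0 add0r.
apply: (@cvg_trans _ ((f s - f t) / (s - t) * (s - t) + f t @[s --> t^'+])).
  apply: near_eq_cvg; near=> s; rewrite divfK ?subrK // subr_eq0 gt_eqF //.
apply: cvgD; last exact: cvg_cst.
apply: cvgM => //; apply: cvgB; last exact: cvg_cst.
exact: cvg_at_right_filter.
Unshelve. all: by end_near. Qed.

End TimeDomain.
End Calculus.

(** * Estimates for the Kullback-Leibler divergence *)

Section KullbackLeibler.
Variables (R : realType) (X : finType).
Implicit Types (mu nu n : vec R X).

Lemma mul_ln_ratio_ge (y m : R) : 0 <= y -> 0 < m -> y - m <= y * ln (y / m).
Proof.
rewrite le_eqVlt => /orP[/eqP<- m0|y0 m0]; first
  by rewrite !mul0r sub0r lerNl oppr0 ltW.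
have -> : ln (y / m) = - ln (1 + (m / y - 1)).
  by rewrite addrC subrK -(invf_div m y) lnV // posrE divr_gt0.
have h : ln (1 + (m / y - 1)) <= m / y - 1.
  by apply: le_ln1Dx; rewrite ltrBDl addrN divr_gt0.
rewrite mulrN lerNr opprB (le_trans (ler_wpM2l (ltW y0) h)) //.
by rewrite mulrBr mulrCA mulfV ?mulr1 // gt_eqF.
Qed.

Lemma mul_ln_ratio_le (y m : R) : 0 <= y -> 0 < m -> y * ln (y / m) <= y * (y - m) / m.
Proof.
rewrite le_eqVlt => /orP[/eqP<- m0|y0 m0]; first by rewrite !mul0r.
rewrite -mulrA ler_wpM2l ?(ltW y0) //.
have -> : y / m = 1 + (y - m) / m by field; rewrite gt_eqF.
apply: le_ln1Dx; have -> : (y - m) / m = y / m - 1 by field; rewrite gt_eqF.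
by rewrite ltrBDl addrN divr_gt0.
Qed.

(** The other terms are at least [nu y - mu y], and these sum to at least [-1]. *)
Lemma KL_term_le mu nu x : (forall y, 0 <= (nu y : R)) -> (forall y, 0 < (mu y : R)) ->
  \sum_y (nu y : R) = 1 -> \sum_y (mu y : R) = 1 ->
  nu x * ln (nu x / mu x : R) <= KL nu mu + 1.
Proof.
move=> nu0 mu0 nu1 mu1; rewrite /KL (bigD1 x) //= -addrA lerDl.
have h : \sum_(y | y != x) ((nu y : R) - mu y) <=
    \sum_(y | y != x) nu y * ln (nu y / mu y : R).
  by apply: ler_sum => y _; exact: mul_ln_ratio_ge.
rewrite -lerBlDr sub0r (le_trans _ h) // sumrB lerBrDl addrC.
move: mu1 nu1; rewrite (bigD1 x) //= => mu1.
have s0 : 0 <= \sum_(y | y != x) (nu y : R) by apply: sumr_ge0.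
by have := mu0 x; lra.
Qed.

Lemma KL_ge0 mu nu : (forall y, 0 <= (nu y : R)) -> (forall y, 0 < (mu y : R)) ->
  \sum_y (nu y : R) = \sum_y (mu y : R) -> 0 <= KL nu mu.
Proof.
move=> nu0 mu0 numu; rewrite -[0](subrr (\sum_y (mu y : R))) -{1}numu -sumrB.
by apply: ler_sum => y _; exact: mul_ln_ratio_ge.
Qed.

(** Up to a second-order term, the divergence of a point [n] from a point with
    larger support is at most their distance in total variation: to first order
    it is the sum of [n - mu] over the support of [n], and [n - mu] sums to zero. *)
Lemma KL_le_tv mu n (q : R) :
    0 <= q -> (forall y, 0 <= (n y : R)) -> (forall y, 0 < (mu y : R)) ->
    \sum_y ((n - mu) y : R) = 0 ->
    (forall y, n y != 0 -> `|(n - mu) y : R| <= q * mu y) ->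
  KL n mu <= (1 + 2 * q) * tv_norm (n - mu).
Proof.
move=> q0 n0 mu0 sum0 hq.
have -> : (1 + 2 * q) * tv_norm (n - mu) =
    \sum_y (2^-1 * (`|(n - mu) y : R| + (n - mu) y) + q * `|(n - mu) y : R|).
  by rewrite big_split /= -!mulr_sumr big_split /= sum0 addr0 /tv_norm; field.
rewrite /KL; apply: ler_sum => y _; have [ny|ny] := eqVneq (n y) 0.
  rewrite ny mul0r addr_ge0 ?mulr_ge0 // -lerBlDr sub0r.
  by rewrite -normrN ler_norm.
apply: le_trans (mul_ln_ratio_le (n0 y) (mu0 y)) _.
have -> : n y * (n y - mu y) / mu y =
    (n - mu) y + (n - mu) y * ((n - mu) y / mu y) :> R.
  by rewrite addvE oppvE; field; rewrite gt_eqF.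
apply: lerD.
  by have := ler_norm ((n - mu) y : R); lra.
apply: le_trans (ler_norm _) _; rewrite normrM mulrC ler_wpM2r //.
by rewrite normrM normfV (gtr0_norm (mu0 y)) ler_pdivrMr // hq.
Qed.

End KullbackLeibler.

(** * The Fisher-Rao gradient flow *)

Section Flow.
Variables (R : realType) (X : finType) (c : vec R X) (L : set (vec R X)).
Hypothesis affL : affine_set L.
Let P := simplex R X `&` L.
Variables (mu_ : R -> vec R X).
Hypothesis flow : is_fr_gradient_flow P (fun mu => dotp c mu) mu_.
Hypothesis mu0 : pos_orthant R X (mu_ 0).
Implicit Types (nu v : vec R X) (s t : R) (x : X).

Lemma flow_mem t : 0 <= t -> P (mu_ t).
Proof. by move=> /flow[[]]. Qed.

(** A relative interior point can be pushed slightly away from a positive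
    point, so it is itself positive. *)
Lemma flow_gt0 t x : 0 <= t -> 0 < (mu_ t x : R).
Proof.
move=> t0; have [[Pmu [e e0 he]] _] := flow t0.
pose r := e / 2; have r0 : 0 < r by rewrite divr_gt0.
have P0 := flow_mem (lexx 0).
have hP := @sub_affine_hull _ _ P.
have /simplex_ge0 : P (mu_ t + r *: (mu_ t - mu_ 0)).
  apply: he => [|y].
    exact: affine_add (@affine_hull_affine _ _ P) (hP _ Pmu) (hP _ P0) (hP _ Pmu).
  rewrite addvE addrC addKr scalevE addvE oppvE normrM (gtr0_norm r0).
  have dle1 : `|(mu_ t y : R) - mu_ 0 y| <= 1.
    have := simplex_le1 y Pmu; have := simplex_le1 y P0.
    have := simplex_ge0 y Pmu; have := simplex_ge0 y P0.
    by rewrite ler_norml; lra.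
  by rewrite (le_lt_trans (ler_wpM2l (ltW r0) dle1)) // mulr1 ltr_pdivrMr //; lra.
move=> /(_ x); rewrite addvE scalevE addvE oppvE => h.
have rm0 : 0 < r * mu_ 0 x by rewrite mulr_gt0 // mu0.
rewrite ltNge; apply/negP => m_le0.
have : r * mu_ t x <= 0 by rewrite mulr_ge0_le0 // ltW.
lra.
Qed.

Lemma euclid_grad_dotp mu : euclid_grad (fun mu => dotp c mu) mu = c.
Proof.
apply: vecP => x; rewrite ffunE.
have -> : (fun h : R => dotp c (mu + h *: basis_vec R x)) =
    (fun h => dotp c mu + h * c x).
  apply/funext => h; rewrite dotpD dotpZ; congr (_ + _ * _).
  rewrite /dotp (bigD1 x) //= big1 ?addr0 /basis_vec ?ffunE ?eqxx ?mulr1 //.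
  by move=> z zx; rewrite ffunE (negPf zx) mulr0.
rewrite derive1E; apply: derive_val; apply/is_derive1_caratheodory.
exists (fun=> c x); split=> // [z|]; last exact: cvg_cst.
by rewrite mul0r addr0 subr0 addrC addKr mulrC.
Qed.

(** The velocity [v], with the metric unfolded: the positivity of [dotp c v] is that
    of the metric, and the last identity pairs [v] with [nu - mu_t], the sum of
    [v] being zero. *)
Lemma flow_deriv t : 0 <= t -> exists2 v : vec R X,
  [/\ \sum_x (v x : R) = 0, 0 <= dotp c v &
  forall nu, P nu -> \sum_x (nu x * (v x / mu_ t x) : R) = dotp c nu - dotp c (mu_ t)] &
  has_time_derivative mu_ t v.
Proof.
move=> t0; have [[Pmu _] [v [Tv gv] dv]] := flow t0; exists v => //.
have v0 := tangent_sum0 affL Tv; split=> //.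
  rewrite -(euclid_grad_dotp (mu_ t)) -gv // sumr_ge0 // => x _.
  by rewrite -expr2 divr_ge0 ?sqr_ge0 // ltW // flow_gt0.
move=> nu Pnu; rewrite -dotpB -{1}(euclid_grad_dotp (mu_ t)) -gv; last exact: tangentB.
have -> : \sum_x (nu x * (v x / mu_ t x) : R) =
    \sum_x (nu x * (v x / mu_ t x) - v x : R) by rewrite sumrB v0 subr0.
apply: eq_bigr => x _; rewrite addvE oppvE.
by field; rewrite gt_eqF // flow_gt0.
Qed.

Lemma KL_right_continuous nu t : (forall x, 0 <= (nu x : R)) -> 0 <= t ->
  KL nu (mu_ s) @[s --> t^'+] --> KL nu (mu_ t).
Proof.
move=> nu0 t0; have [v _ dv] := flow_deriv t0; apply: cvg_finsum => x.
have [->|nux] := eqVneq (nu x : R) 0.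
  by under eq_fun do rewrite mul0r; rewrite mul0r; exact: cvg_cst.
apply: cvgM; first exact: cvg_cst.
have m0 := flow_gt0 x t0.
apply: (@cvg_comp _ _ _ (fun s => nu x / mu_ s x : R) (@ln R)); last first.
  by apply: continuous_ln; rewrite divr_gt0 // lt_def nu0 nux.
apply: cvgM; first exact: cvg_cst.
apply: cvgV; first by rewrite gt_eqF.
exact: right_continuous_within_nonneg (dv x) t0.
Qed.

Lemma is_derive_KL nu t : P nu -> 0 < t ->
  is_derive t 1 (fun s => KL nu (mu_ s)) (- (dotp c nu - dotp c (mu_ t))).
Proof.
move=> Pnu t0; have [v [_ _ <-//] dv] := flow_deriv (ltW t0).
rewrite -sumrN; apply: is_derive1_sum => x.
have [->|nux] := eqVneq (nu x : R) 0.
  by under eq_fun do rewrite mul0r; rewrite mul0r oppr0; exact: is_derive_cst.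
have m0 := flow_gt0 x (ltW t0).
have n0 : 0 < (nu x : R) by rewrite lt_def nux (simplex_ge0 x Pnu).
have dm := is_derive_within_nonneg (dv x) t0.
have dV := is_deriveV (lt0r_neq0 m0) dm.
have dZ := is_deriveZ (nu x : R) dV.
have q0 : 0 < (nu x / mu_ t x : R) by rewrite divr_gt0.
have dL := @is_derive1_comp R (@ln R) (fun s => nu x / mu_ s x) t _ _
  (is_derive1_ln q0) dZ.
apply: (is_derive_eq (is_deriveZ (nu x : R) dL)).
rewrite /GRing.scale /=; field.
by rewrite !gt_eqF.
Qed.

Lemma is_derive_dotp t : 0 < t ->
  exists2 l, 0 <= l & is_derive t 1 (fun s => dotp c (mu_ s)) l.
Proof.
move=> t0; have [v [_ cv _] dv] := flow_deriv (ltW t0).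
exists (dotp c v) => //; apply: is_derive1_sum => x.
exact: is_deriveZ (is_derive_within_nonneg (dv x) t0).
Qed.

Section Optimum.
Variable nu : vec R X.
Hypothesis Fnu : argmax_face P c nu.
Let gap t : R := dotp c nu - dotp c (mu_ t).

Lemma gap_ge0 t : 0 <= t -> 0 <= gap t.
Proof. by move=> t0; rewrite subr_ge0 Fnu.2 //; exact: flow_mem. Qed.

Lemma KL_nonincr s t : 0 <= s -> s <= t -> KL nu (mu_ t) <= KL nu (mu_ s).
Proof.
move=> s0 st; apply: (le_of_derive_le0 (f := fun r => KL nu (mu_ r))
  (df := fun r => - gap r)) => //.
- by move=> r /andP[sr _]; exact: is_derive_KL Fnu.1 (le_lt_trans s0 sr).
- exact: KL_right_continuous (fun x => simplex_ge0 x Fnu.1) s0.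
- by move=> r /andP[sr _]; rewrite oppr_le0 gap_ge0 // ltW // (le_lt_trans s0 sr).
Qed.

(** Up to time [t] the divergence decreases at a rate at least [gap t], since the
    gap is nonincreasing. *)
Lemma gap_le_KL s t : 0 <= s -> s <= t -> (t - s) * gap t <= KL nu (mu_ s).
Proof.
move=> s0 st; have t0 := le_trans s0 st.
have nondecr r : s < r -> r <= t -> gap t <= gap r.
  move=> sr rt; have r0 := le_lt_trans s0 sr.
  pose dc (u : R) : R := dotp c (mu_ u).
  have h (u : R) : exists l : R, 0 < u -> 0 <= l /\ is_derive u 1 dc l.
    have [u0|u0] := ltP 0 u; last by exists 0.
    by have [l l0 dl] := is_derive_dotp u0; exists l.
  have [l hl] := choice h.
  rewrite lerB // -[leLHS]opprK -[leRHS]opprK lerN2.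
  apply: (le_of_derive_le0 (f := fun u => - dc u) (df := fun u => - l u)) => //.
  - by move=> u /andP[ru _]; apply: is_deriveN; apply: (hl u _).2; exact: lt_trans ru.
  - apply: cvgN; apply: cvg_at_right_filter.
    exact: is_derive1_continuous (hl r r0).2.
  - by move=> u /andP[ru _]; rewrite oppr_le0; apply: (hl u _).1; exact: lt_trans ru.
have : KL nu (mu_ t) + gap t * t <= KL nu (mu_ s) + gap t * s.
  apply: (le_of_derive_le0 (f := fun r => KL nu (mu_ r) + gap t * r)
    (df := fun r => - gap r + gap t)) => //.
  - move=> r /andP[sr _]; apply: is_deriveD.
      by exact: is_derive_KL Fnu.1 (le_lt_trans s0 sr).
    apply: is_derive_eq (is_deriveZ (gap t) (is_derive_id r 1)) _.
    by rewrite /GRing.scale /= mulr1.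
  - apply: cvgD.
      exact: KL_right_continuous (fun x => simplex_ge0 x Fnu.1) s0.
    by apply: cvgM; [exact: cvg_cst|exact: cvg_at_right_filter].
  - by move=> r /andP[sr rt]; rewrite addrC subr_le0 nondecr // ltW.
have : 0 <= KL nu (mu_ t).
  apply: KL_ge0 => [y|y|]; [exact: simplex_ge0 Fnu.1|exact: flow_gt0|].
  by rewrite (simplex_sum1 Fnu.1) (simplex_sum1 (flow_mem t0)).
have -> : (t - s) * gap t = gap t * t - gap t * s by ring.
lra.
Qed.

(** On the optimal face the divergences from the moving point all change by the
    same amount; hence [nu], once the closest point of that face, remains so. *)
Lemma KL_min_invariant n t :
    (forall q, argmax_face P c q -> KL nu (mu_ 0) <= KL q (mu_ 0)) ->
  argmax_face P c n -> 0 <= t -> KL nu (mu_ t) <= KL n (mu_ t).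
Proof.
move=> min Fn t0.
suff : KL nu (mu_ t) - KL n (mu_ t) <= KL nu (mu_ 0) - KL n (mu_ 0).
  by have := min n Fn; lra.
apply: (le_of_derive_le0 (f := fun r => KL nu (mu_ r) - KL n (mu_ r))
  (df := fun=> 0)) => //.
- move=> r /andP[r0 _].
  apply: is_derive_eq (is_deriveB (is_derive_KL Fnu.1 r0) (is_derive_KL Fn.1 r0)) _.
  have -> : dotp c n = dotp c nu.
    by apply/eqP; rewrite eq_le Fnu.2 ?Fn.2 //; [exact: Fnu.1|exact: Fn.1].
  by rewrite subrr.
- apply: cvgB.
    exact: KL_right_continuous (fun x => simplex_ge0 x Fnu.1) (lexx 0).
  exact: KL_right_continuous (fun x => simplex_ge0 x Fn.1) (lexx 0).
Qed.

End Optimum.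

(** The divergence from an optimal [q] stays bounded along the flow, which keeps
    the coordinates in the support of [q] away from zero. *)
Lemma flow_lower_bound : exists2 eta : R, 0 < eta &
  forall x, (exists2 q, argmax_face P c q & q x <> 0) ->
  forall t, 0 <= t -> eta <= mu_ t x.
Proof.
have h x : exists eta : R, 0 < eta /\
    ((exists2 q, argmax_face P c q & q x <> 0) ->
      forall t, 0 <= t -> eta <= mu_ t x).
  have [[q Fq qx]|no] := pselect (exists2 q, argmax_face P c q & q x <> 0);
    last by exists 1.
  have q0 : 0 < (q x : R) by rewrite lt_def (simplex_ge0 x Fq.1) andbT; exact/eqP.
  pose K := (KL q (mu_ 0) + 1) / q x.
  exists (q x * expR (- K)); split=> [|_ t t0]; first by rewrite mulr_gt0 ?expR_gt0.
  have m0 := flow_gt0 x t0.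
  have lnq : q x * ln (q x / mu_ t x : R) <= KL q (mu_ 0) + 1.
    apply: le_trans (KL_term_le x _ _ _ _) _.
    - by move=> y; exact: simplex_ge0 Fq.1.
    - by move=> y; exact: flow_gt0.
    - exact: simplex_sum1 Fq.1.
    - exact: simplex_sum1 (flow_mem t0).
    - by rewrite lerD2r KL_nonincr.
  have : expR (ln (q x / mu_ t x : R)) <= expR K.
    by rewrite ler_expR ler_pdivlMr // mulrC.
  rewrite lnK ?posrE ?divr_gt0 //.
  by rewrite ler_pdivrMr // expRN ler_pdivrMr ?expR_gt0 // mulrC.
have [eta heta] := choice h.
exists (\big[Order.min/1]_x eta x).
  by apply: lt_bigmin => // x _; exact: (heta x).1.
move=> x hx t t0; apply: le_trans (bigmin_le _ x _) _.
exact: (heta x).2.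
Qed.

(** The point [n] obtained from [mu_ t] by discarding the edges that leave the
    optimal face satisfies [KL n (mu_ t) <= (1 + 2 * q) * gap / D], where [q] bounds
    the relative displacement of the coordinates and tends to 0 with the gap. The
    slack between [kappa] and [D] pays for the factor [1 + 2 * q]. *)
Lemma gap_ge_KL D kappa nu : 0 < D -> lbound (slopes P c) D -> 0 < kappa < D ->
    argmax_face P c nu ->
    (forall q, argmax_face P c q -> KL nu (mu_ 0) <= KL q (mu_ 0)) ->
  exists2 t0 : R, 0 < t0 & forall t, t0 <= t ->
    kappa * KL nu (mu_ t) <= dotp c nu - dotp c (mu_ t).
Proof.
move=> D0 Dlb /andP[k0 kD] Fnu min.
have [eta eta0 heta] := flow_lower_bound.
have [p Fp bp] := exists_basic affL Fnu.
have cp : dotp c p = dotp c nu.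
  by apply/eqP; rewrite eq_le Fnu.2 ?Fp.2 //; [exact: Fnu.1|exact: Fp.1].
(* q <= 1 makes n nonnegative; the other bound is 1 + 2 q <= D / kappa. *)
pose q0 : R := Num.min 1 ((D / kappa - 1) / 2).
have q0_gt0 : 0 < q0 by rewrite lt_min ltr01 divr_gt0 // subr_gt0 ltr_pdivlMr ?mul1r.
pose K := KL nu (mu_ 0).
have K_ge0 : 0 <= K.
  apply: KL_ge0 => [y|y|]; [exact: simplex_ge0 Fnu.1|exact: flow_gt0|].
  by rewrite (simplex_sum1 Fnu.1) (simplex_sum1 (flow_mem (lexx 0))).
(* From this time on, gap <= K / t forces q <= q0. *)
pose t0 := 2 * K / (D * eta * q0) + 1.
have t0_gt0 : 0 < t0.
  by rewrite ltr_pwDr // divr_ge0 ?mulr_ge0 // ltW // !mulr_gt0.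
exists t0 => // t t0t; have t_gt0 := lt_le_trans t0_gt0 t0t.
have t_ge0 := ltW t_gt0; have Pmu := flow_mem t_ge0.
set mu := mu_ t in Pmu *; set gap := dotp c nu - dotp c mu.
have gap0 : 0 <= gap by exact: gap_ge0.
pose q := 2 * gap / (D * eta).
have De0 : 0 < D * eta by rewrite mulr_gt0.
have q_ge0 : 0 <= q by rewrite divr_ge0 ?mulr_ge0 // ltW.
have qq0 : q <= q0.
  rewrite ler_pdivrMr //.
  have : t * gap <= K by have := gap_le_KL Fnu (lexx 0) t_ge0; rewrite subr0.
  have : 2 * K <= t * (D * eta * q0).
    rewrite -ler_pdivrMr; last by rewrite !mulr_gt0.
    by apply: le_trans t0t; rewrite lerDl.
  move=> h1 h2; rewrite -(ler_pM2l t_gt0); apply: le_trans (_ : 2 * K <= _).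
    by rewrite mulrCA ler_wpM2l.
  by rewrite (le_trans h1) // (mulrC q0).
have [n [Tn cn nF nD]] := optimal_part affL bp Fp (ltW D0) Dlb Pmu.
rewrite cp -/gap in nD.
have tv_le : tv_norm (n - mu) <= gap / D by rewrite ler_pdivlMr // mulrC.
have near x : n x != 0 -> `|(n - mu) x : R| <= q * mu x.
  move=> nx; have [p' Fp' p'x] : exists2 q, argmax_face P c q & q x <> 0.
    apply: contrapT => no; move/eqP: nx; apply; apply: nF => p' Fp'.
    by apply: contrapT => p'x; apply: no; exists p'.
  have eta_le := heta x (ex_intro2 _ _ p' Fp' p'x) t t_ge0.
  apply: le_trans (tv_norm_ge _ _) _.
  apply: le_trans (_ : 2 * (gap / D) <= _); first by rewrite ler_wpM2l.
  apply: le_trans (ler_wpM2l q_ge0 eta_le).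
  have -> // : q * eta = 2 * (gap / D).
  by rewrite /q; field; rewrite !gt_eqF.
have n0 x : 0 <= (n x : R).
  have [->//|/near] := eqVneq (n x) 0.
  have mu0' : 0 < (mu x : R) by exact: flow_gt0.
  have : q * mu x <= 1 * mu x.
    by apply: ler_wpM2r (ltW mu0') _ _ (le_trans qq0 _); rewrite ge_min lexx.
  by rewrite addvE oppvE ler_norml mul1r => h /andP[h' _]; lra.
have Fn : argmax_face P c n.
  split=> [|u /Fp.2]; last by rewrite cn.
  have -> : n = mu + (n - mu) by rewrite addrC subrK.
  by apply: shift_mem => // x; rewrite addvE oppvE addrC subrK.
have KLn : KL n mu <= (1 + 2 * q) * tv_norm (n - mu).
  apply: KL_le_tv => // [y|]; first exact: flow_gt0.
  exact: tangent_sum0 Tn.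
have : KL nu mu <= (1 + 2 * q) * (gap / D).
  apply: le_trans (KL_min_invariant Fnu min Fn t_ge0) (le_trans KLn _).
  by rewrite ler_wpM2l // addr_ge0 // mulr_ge0.
move=> /(ler_wpM2l (ltW k0)) /le_trans; apply.
have q_le : 1 + 2 * q <= D / kappa.
  have : q0 <= (D / kappa - 1) / 2 by rewrite ge_min lexx orbT.
  by lra.
have gD : 0 <= gap / D by rewrite divr_ge0 // ltW.
apply: le_trans (ler_wpM2l (ltW k0) (ler_wpM2r gD q_le)) _.
have -> // : kappa * (D / kappa * (gap / D)) = gap.
by field; rewrite !gt_eqF.
Qed.

(** The integrating factor [expR (kappa * s)] turns the differential inequality
    into monotonicity. *)
Lemma KL_exp_decay kappa nu t0 t : argmax_face P c nu -> 0 < t0 -> t0 <= t ->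
    (forall s, t0 <= s -> kappa * KL nu (mu_ s) <= dotp c nu - dotp c (mu_ s)) ->
  KL nu (mu_ t) <= KL nu (mu_ t0) * expR (- kappa * (t - t0)).
Proof.
move=> Fnu t0_gt0 t0t h.
pose E s : R := expR (kappa * s).
have dE s : is_derive s 1 E (kappa * E s).
  have dl := is_deriveZ kappa (is_derive_id (s : R) (1 : R)).
  apply: is_derive_eq (@is_derive1_comp R (@expR R) (fun s => kappa * s) s _ _
    (is_derive_expR _) dl) _.
  by rewrite /GRing.scale /= mulr1 mulrC.
have dV s : t0 <= s -> is_derive s 1 (fun s => KL nu (mu_ s) * E s)
    ((kappa * KL nu (mu_ s) - (dotp c nu - dotp c (mu_ s))) * E s).
  move=> t0s; apply: is_derive_eq (is_deriveM
    (is_derive_KL Fnu.1 (lt_le_trans t0_gt0 t0s)) (dE s)) _.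
  by rewrite /GRing.scale /=; ring.
have : KL nu (mu_ t) * E t <= KL nu (mu_ t0) * E t0.
  apply: (le_of_derive_le0 (f := fun s => KL nu (mu_ s) * E s) t0t).
  - by move=> s /andP[t0s _]; apply: dV; exact: ltW.
  - apply: cvg_at_right_filter; exact: is_derive1_continuous (dV t0 _).
  - move=> s /andP[/ltW t0s _].
    by rewrite mulr_le0_ge0 ?expR_ge0 // subr_le0 h.
rewrite -ler_pdivlMr ?expR_gt0 // => /le_trans; apply.
rewrite -mulrA /E -expRN -expRD.
by have -> : kappa * t0 + - (kappa * t) = - kappa * (t - t0) by ring.
Qed.

End Flow.

(** * Exponential convergence *)

Unset Implicit Arguments.

Theorem theorem3p13 (R : realType) (X : finType) (c : vec R X)
    (L P Fstar : set (vec R X))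
    (hL : affine_set L)
    (hP : P = simplex R X `&` L)
    (hPpos : P `&` pos_orthant R X !=set0)
    (mu_ : R -> vec R X)
    (hflow : is_fr_gradient_flow P (fun mu => dotp c mu) mu_)
    (hmu0 : (P `&` pos_orthant R X) (mu_ 0))
    (hF : Fstar = argmax_face P c)
    (hFP : Fstar <> P)
    (mustar : vec R X)
    (hmustar : is_info_projection Fstar (mu_ 0) mustar) :
  exists Delta : R,
    [/\ is_min (slopes P c) Delta,
        0 < Delta &
        forall kappa : R, 0 < kappa < Delta ->
        exists2 tk : R, 0 <= tk &
          forall t : R, tk <= t ->
            KL mustar (mu_ t) <= KL mustar (mu_ 0) * expR (- kappa * (t - tk)) /\
            dotp c mustar - dotp c (mu_ t)
              <= Delta * KL mustar (mu_ 0) * expR (- kappa * (t - tk))].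
Proof.
subst P Fstar; set P := simplex R X `&` L in hflow hmu0 hFP hmustar *.
case: hmustar => Fm mmin; case: hmu0 => Pmu0 mu0.
have [mu Pmu nFmu] : exists2 mu, P mu & ~ argmax_face P c mu.
  apply: contrapT => no; apply: hFP; apply/seteqP; split=> [mu []//|mu Pmu].
  by apply: contrapT => nF; apply: no; exists mu.
have [D [Dslope Dlb]] :=
  finite_is_min (finite_slopes hL c) (slopes_neq0 hL Fm Pmu nFmu).
have D0 := slopes_gt0 Dslope.
exists D; split=> // kappa kD; have /andP[k0 _] := kD.
have [t0 t0_gt0 ht0] := gap_ge_KL hL hflow mu0 D0 Dlb kD Fm mmin.
set V := fun t => KL mustar (mu_ t); set V0 := KL mustar (mu_ 0).
have t0_ge0 := ltW t0_gt0.
have V0_ge0 : 0 <= V0.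
  apply: KL_ge0 => [y|y|//]; [exact: simplex_ge0 Fm.1| |].
    exact: flow_gt0 hflow mu0 _ _ (lexx 0).
  by rewrite (simplex_sum1 Fm.1) (simplex_sum1 Pmu0).
have decay t : t0 <= t -> V t <= V0 * expR (- kappa * (t - t0)).
  move=> t0t; apply: le_trans (KL_exp_decay hL hflow mu0 Fm t0_gt0 t0t ht0) _.
  by rewrite ler_wpM2r ?expR_ge0 // (KL_nonincr hL hflow mu0 Fm).
(* The delay 1 is for bounding the gap by the divergence one time unit earlier; the
   further delay makes the resulting constant at most D. *)
pose tk := t0 + 1 + (D * kappa)^-1.
have Dk0 : 0 < D * kappa by rewrite mulr_gt0.
have Dki : 0 < (D * kappa)^-1 by rewrite invr_gt0.
exists tk; first by rewrite /tk; lra.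
move=> t tkt; have t0t : t0 + 1 <= t by apply: le_trans tkt; rewrite lerDl ltW.
split.
  apply: le_trans (decay t _) _; first lra.
  rewrite ler_wpM2l // ler_expR !mulNr lerN2 ler_pM2l // lerD2l lerN2 /tk; lra.
have h1 : 0 <= t - 1 by lra.
have h2 : t - 1 <= t by lra.
have := gap_le_KL hL hflow mu0 Fm h1 h2.
have -> : t - (t - 1) = 1 by ring.
rewrite mul1r => /le_trans; apply.
apply: le_trans (decay (t - 1) _) _; first lra.
rewrite (mulrC D) -mulrA ler_wpM2l //.
have -> : - kappa * (t - 1 - t0) = - D^-1 + - kappa * (t - tk).
  by rewrite /tk; field; rewrite !gt_eqF.
rewrite expRD ler_wpM2r ?expR_ge0 // expRN invf_ple ?posrE ?expR_gt0 //.
by apply: le_trans (expR_ge1Dx _); rewrite lerDr.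
Qed.
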